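(* Let $N$ be a Fibonacci pseudoprime. Then there exists $(i,j) \in \mathcal{D}_{j \leq i}$ with $i+j = N-2$ such that $S^N_{i,j}\not\equiv 0 \pmod{N}$.
   Context: The Lucas numbers are defined by $L_0=2$, $L_1=1$, $L_n=L_{n-1}+L_{n-2}$. A Fibonacci pseudoprime is a composite integer $N$ such that $L_N \equiv 1 \pmod N$. $\mathcal{D}_{j\le i}$ is the set of integer pairs $(i,j)$ with $0 \le j \le i \le N-1$. For $(i,j)\in\mathcal{D}_{j\le i}$, $S^N_{i,j} = \binom{i}{j} + \binom{N-1-j}{N-1-i}$. *)

(* Defs.v *)
From mathcomp Require Import all_boot.

Set Implicit Arguments.
Unset Strict Implicit.
Unset Printing Implicit Defensive.

Fixpoint lucas (n : nat) : nat :=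
  match n with
  | 0 => 2
  | 1 => 1
  | (m.+1 as p).+1 => lucas p + lucas m
  end.

Definition composite (N : nat) : bool := (1 < N) && ~~ prime N.

Definition fibonacci_pseudoprime (N : nat) : Prop :=
  composite N /\ lucas N = 1 %[mod N].

(* The index pairs are naturals: the constraint 0 <= j <= i makes both
   coordinates nonnegative. *)
Definition D_le (N : nat) : pred (nat * nat) :=
  [pred p | p.2 <= p.1 <= N - 1].

(* On D_le N the subtractions are exact when 0 < N. *)
Definition S_coef (N i j : nat) : nat := 'C(i, j) + 'C(N - 1 - j, N - 1 - i).

(* Main.v *)
Require Import Defs.
From mathcomp Require Import all_boot.

(** On the line [i + j = N - 2], put [k = j + 1].  There the sum
    [S_coef N i j] is [C(N-k-1, k-1) + C(N-k, k)], which is the Lucas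
    polynomial coefficient [N/k * C(N-k-1, k-1)].  Taking for [k] a prime
    divisor [p] of the composite number [N], so that [2p <= N], this is
    [(N/p) * C(N-p-1, p-1)]; it is divisible by [N] exactly when [p] divides
    [C(N-p-1, p-1)].  But [N-p-1] is congruent to [-1] modulo [p], and
    [C(-1, p-1)] is a sign modulo [p], so [p] does not divide it
    ([prime_ndvd_bin_pred]). *)

(** Modulo [p] the row [n] is that of [-1]: [p] divides [C(n+1, j+1)] for
    [j + 1 < p], so Pascal's rule makes consecutive entries of the row
    opposite to each other, starting from [C(n, 0) = 1]. *)
Lemma prime_ndvd_bin_pred (p n j : nat) :
  prime p -> p %| n.+1 -> j < p -> ~~ (p %| 'C(n, j)).
Proof.
move=> p_pr p_dvd; elim: j => [|j IHj] lt_jp.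
  by rewrite bin0 Euclid_dvd1.
have p_bin : p %| 'C(n.+1, j.+1).
  have: p %| j.+1 * 'C(n.+1, j.+1) by rewrite -mul_bin_diag dvdn_mulr.
  by rewrite Euclid_dvdM // gtnNdvd.
apply: contraL p_bin => p_dvd_bin.
by rewrite binS dvdn_addr // IHj // ltnW.
Qed.

(** The closed form [N/k * C(N-k-1, k-1)] of the sum, with the division
    cleared and [k = j + 1], [N = i + j + 2]. *)
Lemma mul_bin_add_diag (i j : nat) :
  j.+1 * ('C(i, j) + 'C(i.+1, j.+1)) = (i + j).+2 * 'C(i, j).
Proof. by rewrite mulnDr -mul_bin_diag -mulnDl addSn addnS addnC. Qed.

Theorem theorem3p6 (N : nat) (hN : fibonacci_pseudoprime N) :
  exists i j : nat,
    [/\ (i, j) \in D_le N, i + j = N - 2 & S_coef N i j <> 0 %[mod N]].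
Proof.
case: hN => /andP[N_gt1 N_npr] _.
have p_pr := pdiv_prime N_gt1; have := pdiv_dvd N.
move: (pdiv N) p_pr => p p_pr /dvdnP[m defN].
have p_gt0 := prime_gt0 p_pr.
have m_gt1 : 1 < m.
  case: m defN => [|[|m]] // defN; first by rewrite defN in N_gt1.
  by rewrite defN mul1n p_pr in N_npr.
have le_2pN : p + p <= N by rewrite defN addnn -mul2n leq_mul2r m_gt1 orbT.
pose j := p.-1; pose i := N - p.+1.
have defp : p = j.+1 by rewrite prednK.
have lt_pN : p < N by rewrite (leq_trans _ le_2pN) // -addn1 leq_add2l.
have defNij : N = (i + j).+2 by rewrite -addnS -defp -addnS subnK.
have le_ji : j <= i by move: le_2pN; rewrite defNij defp addSn addnS !ltnS leq_add2r.
have ji_D : (i, j) \in D_le N.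
  by rewrite inE /= le_ji defNij subn1 /= -addnS leq_addr.
exists i, j; split=> //; first by rewrite defNij subn2.
have -> : S_coef N i j = 'C(i, j) + 'C(i.+1, j.+1).
  by rewrite /S_coef defNij subn1 /= -addSn addnK addSnnS addKn.
rewrite mod0n; apply/eqP; rewrite -/(dvdn _ _).
(* Multiplying by [p] turns [N %| S] into [p * N %| N * 'C(i, j)]. *)
rewrite -(dvdn_pmul2l (ltn0Sn j)) mul_bin_add_diag -defNij mulnC -defp.
rewrite dvdn_pmul2l ?(ltnW N_gt1) //.
apply: prime_ndvd_bin_pred; rewrite // ?defp //.
have -> : i.+1 = N - p by rewrite -subSn.
by rewrite -defp dvdn_sub // defN dvdn_mull.
Qed.
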